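(* $\mathrm{ex}'(n,\{\text{nested},\text{crossing},\text{ears}\})\in O(n)$.
   Context: Let $P$ be a set of $n$ points in convex position in the plane (the vertices of a convex $n$-gon); a triangle on $P$ is a 3-element subset of $P$. For two distinct triangles $t_1,t_2$ on $P$, label each point of $t_1\cup t_2$ by the triangle(s) containing it and read the points in their cyclic order around the polygon. The pair forms exactly one of eight configurations. (i) If $t_1,t_2$ share two vertices $u,v$: ''taco'' if their third vertices lie on the same side of the line $uv$, ''mariposa'' if on opposite sides. (ii) If they share exactly one vertex $v$: read the remaining four vertices in cyclic order starting just after $v$; ''bat'' if the pattern is $t_1t_1t_2t_2$ or $t_2t_2t_1t_1$, ''nested'' if it is $t_1t_2t_2t_1$ or $t_2t_1t_1t_2$, ''crossing'' if it is $t_1t_2t_1t_2$ or $t_2t_1t_2t_1$. (iii) If they share no vertex, the cyclic sequence of the six labels is, up to rotation, reflection and exchanging the roles of $t_1,t_2$, one of: ''ears'' $AAABBB$, ''swords'' $AABABB$, ''david'' $ABABAB$. Top/bottom variant: partition the vertices of the convex $n$-gon by a horizontal line into a top half of $\lceil n/2\rceil$ vertices and a bottom half of $\lfloor n/2\rfloor$ vertices (each half consisting of consecutive vertices along the polygon). For a set $X$ of configurations, $\mathrm{ex}'(n,X)$ is the maximum size of a family of triangles on $P$, each having exactly two vertices in the top half and one vertex in the bottom half, in which no two triangles form a configuration belonging to $X$. *)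

(* Defs.v *)
From mathcomp Require Import all_boot.

Set Implicit Arguments.
Unset Strict Implicit.
Unset Printing Implicit Defensive.

(* The vertices of the convex n-gon are the elements 0, ..., n-1 of 'I_n,
   numbered in their cyclic order around the polygon. *)

Inductive config :=
  | Taco | Mariposa | Bat | Nested | Crossing | Ears | Swords | David.

Definition triangle n (t : {set 'I_n}) : bool := #|t| == 3.

(* The vertices belonging to exactly one of t1, t2, read in cyclic order
   starting from v and labelled true for t1 and false for t2.  A vertex shared
   by t1 and t2 is skipped; so if v is shared, the reading starts just after v. *)
Definition reading n (t1 t2 : {set 'I_n}) (v : nat) : seq bool :=
  [seq x \in t1 | x <- rot v (enum 'I_n) & (x \in t1) (+) (x \in t2)].

(* The chord joining u < v separates the vertices numbered strictly between
   u and v from the remaining ones. *)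
Definition same_side n (u v a b : 'I_n) : bool :=
  (u < a < v) == (u < b < v).

Definition share_two n (side : bool) (t1 t2 : {set 'I_n}) : bool :=
  [exists u : 'I_n, exists v : 'I_n, exists a : 'I_n, exists b : 'I_n,
    [&& u < v, t1 :&: t2 == [set u; v],
        t1 :\: t2 == [set a], t2 :\: t1 == [set b] &
        same_side u v a b == side]].

Definition share_one n (w : seq bool) (t1 t2 : {set 'I_n}) : bool :=
  [exists v : 'I_n,
    (t1 :&: t2 == [set v]) &&
    (reading t1 t2 v \in [:: w; map negb w])].

(* Equality of cyclic words of length 6 up to rotation, reflection and
   exchange of the two labels. *)
Definition same_cyclic_word (w w' : seq bool) : bool :=
  [exists r : 'I_6,
    rot r w \in [:: w'; rev w'; map negb w'; map negb (rev w')]].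

Definition share_none n (w : seq bool) (t1 t2 : {set 'I_n}) : bool :=
  (t1 :&: t2 == set0) && same_cyclic_word (reading t1 t2 0) w.

Definition forms n (c : config) (t1 t2 : {set 'I_n}) : bool :=
  match c with
  | Taco => share_two true t1 t2
  | Mariposa => share_two false t1 t2
  | Bat => share_one [:: true; true; false; false] t1 t2
  | Nested => share_one [:: true; false; false; true] t1 t2
  | Crossing => share_one [:: true; false; true; false] t1 t2
  | Ears => share_none [:: true; true; true; false; false; false] t1 t2
  | Swords => share_none [:: true; true; false; true; false; false] t1 t2
  | David => share_none [:: true; false; true; false; true; false] t1 t2
  end.

(* uphalf n is the ceiling of n/2. *)
Definition top n : {set 'I_n} := [set i : 'I_n | i < uphalf n].
Definition bottom n : {set 'I_n} := ~: top n.

Definition top_bottom_family n (F : {set {set 'I_n}}) : bool :=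
  [forall t in F, [&& triangle t, #|t :&: top n| == 2 & #|t :&: bottom n| == 1]].

Definition avoids n (X : seq config) (F : {set {set 'I_n}}) : bool :=
  [forall t1 in F, forall t2 in F,
    (t1 != t2) ==> ~~ has (fun c => forms c t1 t2) X].

(* The maximum is over a set of families containing the empty family. *)
Definition ex' (n : nat) (X : seq config) : nat :=
  \max_(F : {set {set 'I_n}} | top_bottom_family F && avoids X F) #|F|.

(* Main.v *)
(* Write abc for a triangle with top vertices a < b and bottom vertex c. Two
   triangles sharing only a (or only b) are nested or crossing, so as soon as a
   (or b) lies on two top chords, c is determined by it. Two triangles sharing
   only c must have chords with no overlap, and non-ears gives c <= c' when the
   chord ab lies left of the chord a'b'.
   Consequently, if c lies strictly between two other apexes of the chord ab,
   then abc is the only triangle at c: this accounts for at most n triangles.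
   Otherwise c is the smallest or the largest apex of ab, and moreover b is the
   last partner of a or a is the first partner of b (else the two triangles with
   apex c at a farther b' and at an earlier a' would cross at c). Each of these
   four combinations determines the triangle from one of its top vertices, which
   gives at most 5n triangles. *)
Require Import Defs.
From mathcomp Require Import all_boot.
From mathcomp Require Import zify.

Set Implicit Arguments.
Unset Strict Implicit.
Unset Printing Implicit Defensive.

(** * Counting triples under abstract conditions on chords and apexes *)

Section Counting.

Variables (n : nat) (T : 'I_n -> 'I_n -> 'I_n -> bool).

Hypothesis T_lt : forall a b c, T a b c -> a < b.
Hypothesis T_right_star : forall a b c b' c',
  T a b c -> T a b' c' -> b != b' -> c = c'.
Hypothesis T_left_star : forall a b c a' c',
  T a b c -> T a' b c' -> a != a' -> c = c'.
Hypothesis T_chain : forall a b c b' c', T a b c -> T b b' c' -> c' <= c.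
Hypothesis T_apex : forall a b a' b' c, T a b c -> T a' b' c ->
  a != a' -> b != b' -> a != b' -> b != a' -> (b < a') || (b' < a).
Hypothesis T_separated : forall a b c a' b' c',
  T a b c -> T a' b' c' -> b < a' -> c <= c'.

Let topmost a b c := T a b c && [forall x : 'I_n, T a b x ==> (x <= c)].
Let bottommost a b c := T a b c && [forall x : 'I_n, T a b x ==> (c <= x)].
Let rightmost a b c :=
  T a b c && [forall x : 'I_n, forall y : 'I_n, T a x y ==> (x <= b)].
Let leftmost a b c :=
  T a b c && [forall x : 'I_n, forall y : 'I_n, T x b y ==> (a <= x)].
Let inner a b c := T a b c &&
  [exists x : 'I_n, exists y : 'I_n, [&& T a b x, T a b y, x < c & c < y]].

(** Otherwise there are [a' < a < b < b']; the star conditions give the triangles on [a b'] and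
    [a' b] the apex [c], and [T_apex] excludes such overlapping chords. *)
Lemma rightmost_or_leftmost a b c :
  T a b c -> rightmost a b c || leftmost a b c.
Proof.
move=> Tabc; rewrite /rightmost /leftmost Tabc /= -[_ || _]negbK negb_or.
apply/negP => /andP[/forallPn[b' /forallPn[c1]]].
rewrite negb_imply -ltnNge => /andP[T1 ltb] /forallPn[a' /forallPn[c2]].
rewrite negb_imply -ltnNge => /andP[T2 lta].
have c1E : c = c1 by apply: T_right_star Tabc T1 _; rewrite -val_eqE /=; lia.
have c2E : c = c2 by apply: T_left_star Tabc T2 _; rewrite -val_eqE /=; lia.
subst c1 c2; have ltab := T_lt Tabc.
have := T_apex T2 T1; rewrite -!val_eqE /=; lia.
Qed.

(** A second chord at [c] with the same left or right end would force every apex of [ab] to be [c].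
    From left to right, apexes weakly decrease along touching chords and weakly increase along
    separated ones; apexes of [ab] on both sides of [c] refute each case. *)
Lemma inner_inj a b c a' b' : inner a b c -> T a' b' c -> a = a' /\ b = b'.
Proof.
case/andP=> Tabc /existsP[c1 /existsP[c2 /and4P[T1 T2 lt1 lt2]]] T'.
have neq1 : c1 <> c by move=> E; rewrite E ltnn in lt1.
have [eqa|neqa] := eqVneq a a'.
  split=> //; subst a'; have [//|neqb] := eqVneq b b'.
  by have := T_right_star T1 T' neqb.
have [eqb|neqb] := eqVneq b b'.
  by subst b'; have := T_left_star T1 T' neqa.
have [eqab|neqab] := eqVneq a b'.
  by subst b'; have := T_chain T' T2; lia.
have [eqba|neqba] := eqVneq b a'.
  by subst a'; have := T_chain T1 T'; lia.
case/orP: (T_apex Tabc T' neqa neqb neqab neqba) => lt.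
  by have := T_separated T2 T' lt; lia.
by have := T_separated T' T1 lt; lia.
Qed.

Lemma topmost_inj a b c c' : topmost a b c -> topmost a b c' -> c = c'.
Proof.
move=> /andP[T1 /forallP m1] /andP[T2 /forallP m2]; apply: val_inj => /=.
by have := implyP (m1 _) T2; have := implyP (m2 _) T1; lia.
Qed.

Lemma bottommost_inj a b c c' : bottommost a b c -> bottommost a b c' -> c = c'.
Proof.
move=> /andP[T1 /forallP m1] /andP[T2 /forallP m2]; apply: val_inj => /=.
by have := implyP (m1 _) T2; have := implyP (m2 _) T1; lia.
Qed.

Lemma rightmost_inj a b c b' c' :
  rightmost a b c -> rightmost a b' c' -> b = b'.
Proof.
move=> /andP[T1 /forallP m1] /andP[T2 /forallP m2]; apply: val_inj => /=.
have := implyP (forallP (m1 _) _) T2; have := implyP (forallP (m2 _) _) T1.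
by lia.
Qed.

Lemma leftmost_inj a b c a' c' :
  leftmost a b c -> leftmost a' b c' -> a = a'.
Proof.
move=> /andP[T1 /forallP m1] /andP[T2 /forallP m2]; apply: val_inj => /=.
have := implyP (forallP (m1 _) _) T2; have := implyP (forallP (m2 _) _) T1.
by lia.
Qed.

Lemma inner_or_extreme a b c :
  T a b c -> [|| inner a b c, topmost a b c | bottommost a b c].
Proof.
move=> Tabc; rewrite /inner /topmost /bottommost Tabc /=.
have [//|/forallPn[y]] := boolP [forall x : 'I_n, T a b x ==> (x <= c)].
  by rewrite orbT.
rewrite negb_imply -ltnNge => /andP[Ty lty].
have [//|/forallPn[x]] := boolP [forall x : 'I_n, T a b x ==> (c <= x)].
  by rewrite !orbT.
rewrite negb_imply -ltnNge => /andP[Tx ltx].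
apply/orP; left; apply/existsP; exists x; apply/existsP; exists y.
exact/and4P.
Qed.

Let tri (Q : 'I_n -> 'I_n -> 'I_n -> bool) :=
  [set p : 'I_n * 'I_n * 'I_n | Q p.1.1 p.1.2 p.2].

Lemma card_triples : #|tri T| <= 5 * n.
Proof.
pose A1 := tri (fun a b c => topmost a b c && rightmost a b c).
pose A2 := tri (fun a b c => topmost a b c && leftmost a b c).
pose A3 := tri (fun a b c => bottommost a b c && rightmost a b c).
pose A4 := tri (fun a b c => bottommost a b c && leftmost a b c).
have sub : tri T \subset tri inner :|: A1 :|: A2 :|: A3 :|: A4.
  apply/subsetP => -[[a b] c]; rewrite !inE /= => Tabc.
  move: (rightmost_or_leftmost Tabc) (inner_or_extreme Tabc).
  (* What remains is a truth table in the five predicates at [a b c]. *)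
  by do !case: (_ a b c).
have cI : #|tri inner| <= n.
  rewrite -[leqRHS]card_ord; apply: (leq_card_in (fun p => p.2)).
  move=> [[a b] c] [[a' b'] c']; rewrite !inE /= => I1 /andP[T2 _] E.
  by subst c'; have [-> ->] := inner_inj I1 T2.
(* [rightmost] recovers [b] from [a], then [topmost] recovers [c]; the other three classes are
   handled alike. *)
have c1 : #|A1| <= n.
  rewrite -[leqRHS]card_ord; apply: (leq_card_in (fun p => p.1.1)).
  move=> [[a b] c] [[a' b'] c']; rewrite !inE /= => /andP[t1 r1] /andP[t2 r2] E.
  by subst a'; have E := rightmost_inj r1 r2; subst b'; rewrite (topmost_inj t1 t2).
have c2 : #|A2| <= n.
  rewrite -[leqRHS]card_ord; apply: (leq_card_in (fun p => p.1.2)).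
  move=> [[a b] c] [[a' b'] c']; rewrite !inE /= => /andP[t1 r1] /andP[t2 r2] E.
  by subst b'; have E := leftmost_inj r1 r2; subst a'; rewrite (topmost_inj t1 t2).
have c3 : #|A3| <= n.
  rewrite -[leqRHS]card_ord; apply: (leq_card_in (fun p => p.1.1)).
  move=> [[a b] c] [[a' b'] c']; rewrite !inE /= => /andP[t1 r1] /andP[t2 r2] E.
  by subst a'; have E := rightmost_inj r1 r2; subst b'; rewrite (bottommost_inj t1 t2).
have c4 : #|A4| <= n.
  rewrite -[leqRHS]card_ord; apply: (leq_card_in (fun p => p.1.2)).
  move=> [[a b] c] [[a' b'] c']; rewrite !inE /= => /andP[t1 r1] /andP[t2 r2] E.
  by subst b'; have E := leftmost_inj r1 r2; subst a'; rewrite (bottommost_inj t1 t2).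
apply: leq_trans (subset_leq_card sub) _.
have cU m1 m2 (A B : {set 'I_n * 'I_n * 'I_n}) :
    #|A| <= m1 -> #|B| <= m2 -> #|A :|: B| <= m1 + m2.
  by move=> le1 le2; rewrite cardsU (leq_trans (leq_subr _ _)) ?leq_add.
have -> : 5 * n = n + n + n + n + n by lia.
by do 4!apply: (cU) => //.
Qed.

End Counting.

(** * Cyclic readings as explicit lists of vertices *)

(** A strictly increasing list is determined by its elements. *)
Lemma filter_enum_ord n (P : pred 'I_n) (s : seq 'I_n) :
  sorted (relpre val ltn) s -> s =i P -> [seq x <- enum 'I_n | P x] = s.
Proof.
move=> s_sorted sP; apply: (@irr_sorted_eq _ (relpre val ltn)) => //.
- by move=> x y z; apply: ltn_trans.
- by move=> x; rewrite /= ltnn.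
- apply: sorted_filter; first by move=> x y z; apply: ltn_trans.
  by rewrite -sorted_map val_enum_ord iota_ltn_sorted.
- by move=> x; rewrite mem_filter mem_enum andbT sP.
Qed.

(** Rotating by [v] puts the vertices from [v] on before those below [v], and each block stays
    increasing. *)
Lemma reading_cat n (t1 t2 : {set 'I_n}) (v : nat) (s1 s2 : seq 'I_n) :
  sorted (relpre val ltn) s1 -> sorted (relpre val ltn) s2 ->
  (forall x : 'I_n, (x \in s1) = ((x \in t1) (+) (x \in t2)) && (v <= x)) ->
  (forall x : 'I_n, (x \in s2) = ((x \in t1) (+) (x \in t2)) && (x < v)) ->
  reading t1 t2 v = [seq x \in t1 | x <- s1 ++ s2].
Proof.
move=> s1_sorted s2_sorted s1P s2P; rewrite /reading /rot filter_cat.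
rewrite -(filter_enum_ord s1_sorted s1P) -(filter_enum_ord s2_sorted s2P).
have take_enum : take v (enum 'I_n) = [seq x : 'I_n <- enum 'I_n | x < v].
  apply: (inj_map val_inj); rewrite map_take -(filter_map val (fun i => i < v)).
  rewrite val_enum_ord take_iota.
  apply: (irr_sorted_eq ltn_trans ltnn); rewrite ?iota_ltn_sorted //.
    exact: (sorted_filter ltn_trans) (iota_ltn_sorted _ _).
  by move=> i; rewrite mem_filter !mem_iota; lia.
have drop_enum : drop v (enum 'I_n) = [seq x : 'I_n <- enum 'I_n | v <= x].
  apply: (inj_map val_inj); rewrite map_drop -(filter_map val (fun i => v <= i)).
  rewrite val_enum_ord drop_iota.
  apply: (irr_sorted_eq ltn_trans ltnn); rewrite ?iota_ltn_sorted //.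
    exact: (sorted_filter ltn_trans) (iota_ltn_sorted _ _).
  by move=> i; rewrite mem_filter !mem_iota; lia.
by rewrite take_enum drop_enum -!filter_predI.
Qed.

Ltac ord_lia := rewrite /= ?in_nil ?inE -?val_eqE /=; lia.

Definition nested_word := [:: true; false; false; true].
Definition crossing_word := [:: true; false; true; false].

(** * Deriving the abstract conditions from the forbidden configurations *)

Section Avoiding.

Variables (n : nat) (F : {set {set 'I_n}}).

Hypothesis F_avoids : avoids [:: Nested; Crossing; Ears] F.

(** Bottom vertices are numbered after top ones, so [a < b < c] and each triangle has one triple. *)
Let T (a b c : 'I_n) :=
  [&& a < b, b < uphalf n, uphalf n <= c & [set a; b; c] \in F].

Lemma share_one_avoided w t1 t2 v (s1 s2 : seq 'I_n) :
  w \in [:: nested_word; crossing_word] ->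
  t1 \in F -> t2 \in F -> t1 != t2 -> t1 :&: t2 = [set v] ->
  sorted (relpre val ltn) s1 -> sorted (relpre val ltn) s2 ->
  (forall x : 'I_n, (x \in s1) = ((x \in t1) (+) (x \in t2)) && (v <= x)) ->
  (forall x : 'I_n, (x \in s2) = ((x \in t1) (+) (x \in t2)) && (x < v)) ->
  [seq x \in t1 | x <- s1 ++ s2] = w -> False.
Proof.
move=> wP F1 F2 neq tI h1 h2 h3 h4 wE.
have := implyP (forallP (implyP (forallP F_avoids t1) F1) t2) F2.
rewrite neq /= !negb_or => /and4P[/existsPn/(_ v) nn /existsPn/(_ v) nc _ _].
move: nn nc; rewrite tI eqxx /= (reading_cat h1 h2 h3 h4) wE.
by move: wP; rewrite !inE => /orP[] /eqP->.
Qed.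

(** [s1] and [s2] list the unshared vertices after and before the shared vertex [v]. The order of
    [F1] and [F2] is chosen so that the word starts with [true]; the first vertex read then tells
    the triangles apart. *)
Ltac share_one_contra w v s1 s2 F1 F2 :=
  apply: (@share_one_avoided w _ _ v s1 s2 _ F1 F2);
  [ by []
  | by apply/eqP => /setP /(_ (head v (s1 ++ s2))); ord_lia
  | by apply/setP => x; ord_lia
  | by move=> /=; lia
  | by move=> /=; lia
  | by move=> x; ord_lia
  | by move=> x; ord_lia
  | by rewrite /w /= !inE -!val_eqE /=; repeat (congr cons; first by lia) ].

(** With [b < b'], reading from [a] gives [b b'] and then both apexes: crossing if [c < c'], nested
    if [c' < c]. *)
Lemma T_right_star a b c b' c' : T a b c -> T a b' c' -> b != b' -> c = c'.
Proof.
wlog ltb : b c b' c' / b < b' => [W T1 T2 neq|].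
  case: (ltngtP b b') => [lt|gt|/val_inj E]; first exact: W lt T1 T2 neq.
  - by apply/esym; apply: W gt T2 T1 _; rewrite eq_sym.
  - by rewrite E eqxx in neq.
move=> /and4P[l1 l2 l3 F1] /and4P[l4 l5 l6 F2] _.
apply: val_inj; case: (ltngtP c c') => //= lt; exfalso.
- by share_one_contra crossing_word a [:: b; b'; c; c'] (Nil 'I_n) F1 F2.
- by share_one_contra nested_word a [:: b; b'; c'; c] (Nil 'I_n) F1 F2.
Qed.

Lemma T_left_star a b c a' c' : T a b c -> T a' b c' -> a != a' -> c = c'.
Proof.
wlog lta : a c a' c' / a < a' => [W T1 T2 neq|].
  case: (ltngtP a a') => [lt|gt|/val_inj E]; first exact: W lt T1 T2 neq.
  - by apply/esym; apply: W gt T2 T1 _; rewrite eq_sym.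
  - by rewrite E eqxx in neq.
move=> /and4P[l1 l2 l3 F1] /and4P[l4 l5 l6 F2] _.
apply: val_inj; case: (ltngtP c c') => //= lt; exfalso.
- by share_one_contra crossing_word b [:: c; c'] [:: a; a'] F1 F2.
- by share_one_contra nested_word b [:: c'; c] [:: a; a'] F2 F1.
Qed.

(** If [c < c'], reading from [b] gives [b' c c' a], which alternates. *)
Lemma T_chain a b c b' c' : T a b c -> T b b' c' -> c' <= c.
Proof.
move=> /and4P[l1 l2 l3 F1] /and4P[l4 l5 l6 F2]; rewrite leqNgt; apply/negP => lt.
by share_one_contra crossing_word b [:: b'; c; c'] [:: a] F2 F1.
Qed.

(** Reading from [c] wraps around to the four top vertices; overlapping chords are crossing if they
    interleave and nested if one contains the other. *)
Lemma T_apex a b a' b' c : T a b c -> T a' b' c ->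
  a != a' -> b != b' -> a != b' -> b != a' -> (b < a') || (b' < a).
Proof.
wlog lta : a b a' b' / a < a' => [W T1 T2 n1 n2 n3 n4|].
  case: (ltngtP a a') => [lt|gt|/val_inj E]; first exact: W.
  - by rewrite orbC; apply: (W _ _ _ _ gt) => //; rewrite eq_sym.
  - by rewrite E eqxx in n1.
move=> /and4P[l1 l2 l3 F1] /and4P[l4 l5 l6 F2] _.
rewrite -!val_eqE /= => n2 n3 n4.
case: (ltngtP b a') n4 => //= lt _; case: (ltngtP b b') n2 => //= lt' _; exfalso.
- by share_one_contra crossing_word c (Nil 'I_n) [:: a; a'; b; b'] F1 F2.
- by share_one_contra nested_word c (Nil 'I_n) [:: a; a'; b'; b] F1 F2.
Qed.

Lemma T_separated a b c a' b' c' : T a b c -> T a' b' c' -> b < a' -> c <= c'.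
Proof.
move=> /and4P[l1 l2 l3 F1] /and4P[l4 l5 l6 F2] l7.
rewrite leqNgt; apply/negP => lt.
have := implyP (forallP (implyP (forallP F_avoids _) F1) _) F2.
have -> : [set a; b; c] != [set a'; b'; c'].
  by apply/eqP => /setP /(_ a); ord_lia.
rewrite /= !negb_or => /and4P[_ _ /negP ne _]; apply: ne.
apply/andP; split; first by apply/eqP/setP => x; ord_lia.
rewrite (@reading_cat _ _ _ 0 [:: a; b; a'; b'; c'; c] [::]); first last.
- by move=> x; ord_lia.
- by move=> x; ord_lia.
- by [].
- by move=> /=; lia.
(* Rotating by 5 moves the last letter, that of [c], to the front and yields the ears word. *)
apply/existsP; exists ord_max.
have -> : [seq x \in [set a; b; c] | x <- [:: a; b; a'; b'; c'; c] ++ [::]]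
        = [:: true; true; false; false; false; true].
  by rewrite /= !inE -!val_eqE /=; repeat (congr cons; first by lia).
by [].
Qed.

Lemma family_card : top_bottom_family F -> #|F| <= 5 * n.
Proof.
move=> /forallP F_tb.
apply: leq_trans (card_triples _ T_right_star T_left_star T_chain T_apex
  T_separated); last first.
  by move=> a b c /andP[].
(* It suffices that every member of [F] is the vertex set of some triple. *)
apply: leq_trans (leq_imset_card (fun p => [set p.1.1; p.1.2; p.2]) _).
apply: subset_leq_card; apply/subsetP => t tF.
have /and3P[_ /cards2P[a [b [neq topE]]] /cards1P[c botE]] := implyP (F_tb t) tF.
wlog ltab : a b neq topE / a < b => [W|].
  case: (ltngtP a b) => [lt|gt|/val_inj E]; first exact: W lt.
  - by apply: (W b a) => //; rewrite 1?eq_sym // setUC.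
  - by rewrite E eqxx in neq.
have tE : [set a; b; c] = t by rewrite -topE -botE -setIUr setUCr setIT.
apply/imsetP; exists (a, b, c) => //=; rewrite inE /= /T ltab tE tF andbT /=.
have : b \in t :&: top n by rewrite topE !inE eqxx orbT.
have : c \in t :&: bottom n by rewrite botE inE.
by rewrite !inE -leqNgt => /andP[_ ->] /andP[_ ->].
Qed.

End Avoiding.

(* The asymptotic statement *)
From mathcomp Require Import all_order all_algebra.
From mathcomp Require Import all_classical all_reals all_analysis.
Import numFieldNormedType.Exports.
Import Order.TTheory GRing.Theory Num.Theory.
Local Open Scope classical_set_scope.
Local Open Scope ring_scope.

Theorem theorem6 (R : realType) :
  (fun n : nat => (ex' n [:: Nested; Crossing; Ears])%:R : R)
    =O_\oo (fun n : nat => n%:R : R).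
Proof.
(* The bound is required for all constants [k > 5]; that by [5 * n] holds for every [n] and implies
   it. *)
apply/eqOP; exists 5; split=> // k k5; near=> n.
rewrite !normr_nat; apply: (@le_trans _ _ (5 * n%:R)).
  rewrite -natrM ler_nat; apply/bigmax_leqP => G /andP[G_tb G_avoids].
  exact: family_card G_avoids G_tb.
by rewrite ler_wpM2r ?ler0n // ltW.
Unshelve. all: by end_near.
Qed.
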